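(* Let $a,b\in\mathbb{C}$ and let $(W(a,b),\circ_\lambda,[\cdot_\lambda\cdot])$ be a nontrivial noncommutative TPCA structure over the Lie conformal algebra $W(a,b)=\mathbb{C}[\partial]L\oplus\mathbb{C}[\partial]M$. Then $(W(a,b),\circ_\lambda,[\cdot_\lambda\cdot])$ is isomorphic to $W(a,b)$, with its $\lambda$-bracket, equipped with one of the following $\lambda$-multiplications: (1) $L\circ_\lambda L=s(\lambda)M$, $\ L\circ_\lambda M=M\circ_\lambda L=M\circ_\lambda M=0$; (2) $L\circ_\lambda L=c_1L$, $\ L\circ_\lambda M=c_1M$, $\ M\circ_\lambda L=M\circ_\lambda M=0$; (3) $L\circ_\lambda L=c_1L$, $\ L\circ_\lambda M=M\circ_\lambda L=c_1M$, $\ M\circ_\lambda M=0$; (4) $L\circ_\lambda L=c_1L+M$, $\ L\circ_\lambda M=M\circ_\lambda L=c_1M$, $\ M\circ_\lambda M=0$; (5) $L\circ_\lambda L=cL$, $\ L\circ_\lambda M=cM$, $\ M\circ_\lambda L=L$, $\ M\circ_\lambda M=M$; where $0\neq s(\lambda)\in\mathbb{C}[\lambda]$, $c_1\in\mathbb{C}\setminus\{0\}$, $c\in\mathbb{C}$.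
   Context: All vector spaces, linear maps and tensor products are over $\mathbb{C}$. For a vector space $A$, $A[\lambda]$ denotes polynomials in $\lambda$ with coefficients in $A$. A conformal algebra $(A,\circ_\lambda)$ is a $\mathbb{C}[\partial]$-module $A$ with a $\mathbb{C}$-bilinear map $A\otimes A\to A[\lambda]$, $x\otimes y\mapsto x\circ_\lambda y$, such that $(\partial x)\circ_\lambda y=-\lambda\, x\circ_\lambda y$ and $x\circ_\lambda(\partial y)=(\partial+\lambda)(x\circ_\lambda y)$; it is associative if $x\circ_\lambda(y\circ_\mu z)=(x\circ_\lambda y)\circ_{\lambda+\mu}z$ for all $x,y,z$. Products are extended linearly to polynomials in formal variables; if $[x_\lambda y]=\sum_n\lambda^n w_n$, then $[x_{-\lambda-\partial}y]=\sum_n(-\lambda-\partial)^n w_n$. A Lie conformal algebra $(A,[\cdot_\lambda\cdot])$ is a conformal algebra (with product written $[x_\lambda y]$) such that $[x_\lambda y]=-[y_{-\lambda-\partial}x]$ and $[x_\lambda[y_\mu z]]=[[x_\lambda y]_{\lambda+\mu}z]+[y_\mu[x_\lambda z]]$ for all $x,y,z$. For $a,b\in\mathbb{C}$, $W(a,b)$ is the Lie conformal algebra that is the free $\mathbb{C}[\partial]$-module on $L,M$ with $[L_\lambda L]=(\partial+2\lambda)L$, $[L_\lambda M]=(\partial+a\lambda+b)M$, $[M_\lambda M]=0$ (with $[M_\lambda L]$ determined by skew-symmetry). A noncommutative TPCA structure over a Lie conformal algebra $(A,[\cdot_\lambda\cdot])$ is a $\lambda$-multiplication $\circ_\lambda$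 on the $\mathbb{C}[\partial]$-module $A$ such that $(A,\circ_\lambda)$ is an associative conformal algebra (not necessarily commutative) and $2(x\circ_\lambda[y_\mu z])=[(x\circ_\lambda y)_{\lambda+\mu}z]+[y_\mu(x\circ_\lambda z)]$ for all $x,y,z\in A$. It is nontrivial if $\circ_\lambda$ is not identically zero. By sesquilinearity such a structure on $W(a,b)$ is determined by the products of $L,M$. An isomorphism of such structures is an isomorphism of $\mathbb{C}[\partial]$-modules preserving both $\circ_\lambda$ and $[\cdot_\lambda\cdot]$. *)

(* Defs.v *)
From HB Require Import structures.
From mathcomp Require Import all_boot all_order all_algebra.
From mathcomp Require Import finmap reals complex monalg.

Set Implicit Arguments.
Unset Strict Implicit.
Unset Printing Implicit Defensive.

Import GRing.Theory.
Local Open Scope ring_scope.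

(* A K[d]-module is an [lmodType {poly K}], with d acting by ['X *: _].       *)
(* Polynomials with coefficients in A are the finitely supported families     *)
(* [{malg A[I]}] indexed by an additive monoid I of exponents:                *)
(* A[lambda] is [{malg A[nat]}], A[lambda, mu] is [{malg A[nat * nat]}],      *)
(* and [<< x *g u >>] is the monomial with exponent u and coefficient x.      *)

Section FormalPolynomials.
Variable K : fieldType.

Definition map_coef (A B : lmodType {poly K}) (I : nmodType) (h : A -> B)
    (P : {malg A[I]}) : {malg B[I]} :=
  \sum_(u <- msupp P) << h P@_u *g u >>.

Variables (A : lmodType {poly K}) (I : nmodType).
Implicit Types P Q : {malg A[I]}.

Definition shift (u : I) P : {malg A[I]} :=
  \sum_(v <- msupp P) << P@_v *g u + v >>.

Definition dmul P : {malg A[I]} := map_coef (fun x => 'X *: x) P.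

(* theta is multiplication by some polynomial t in d and the variables; for   *)
(* w = sum_n lambda^n w_n, this is w with t substituted for lambda, the       *)
(* powers of t acting on the w_n from the left.                               *)
Definition subst (theta : {malg A[I]} -> {malg A[I]}) (w : {malg A[nat]}) :
    {malg A[I]} :=
  \sum_(n <- msupp w) iter n theta << w@_n *g 0 >>.

Definition lambda_product := A -> A -> {malg A[nat]}.

(* P o_theta Q, extended linearly to polynomials in formal variables *)
Definition ext (m : lambda_product) (theta : {malg A[I]} -> {malg A[I]}) P Q :
    {malg A[I]} :=
  \sum_(u <- msupp P) \sum_(v <- msupp Q)
    shift (u + v) (subst theta (m P@_u Q@_v)).

End FormalPolynomials.

Section ConformalAlgebras.
Variables (K : fieldType) (A : lmodType {poly K}).
Implicit Types (m op br : lambda_product A) (x y z : A).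

Definition lambda1 (w : {malg A[nat]}) : {malg A[nat]} := shift 1%N w.

Local Notation A2 := {malg A[(nat * nat)%type]}.

Definition cst x : A2 := << x *g (0%N, 0%N) >>.
Definition lam (P : A2) : A2 := shift (1%N, 0%N) P.
Definition mu (P : A2) : A2 := shift (0%N, 1%N) P.
Definition lam_mu (P : A2) : A2 := lam P + mu P.
Definition neg_lam_d (P : A2) : A2 := - lam P - dmul P.

Record conformal m : Prop := Conformal {
  conformal_linl : forall (c : K) x y z,
    m (c%:P *: x + y) z = map_coef (fun w => c%:P *: w) (m x z) + m y z;
  conformal_linr : forall (c : K) x y z,
    m x (c%:P *: y + z) = map_coef (fun w => c%:P *: w) (m x y) + m x z;
  conformal_dl : forall x y, m ('X *: x) y = - lambda1 (m x y);
  conformal_dr : forall x y, m x ('X *: y) = dmul (m x y) + lambda1 (m x y)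
}.

Record assoc_conformal m : Prop := AssocConformal {
  assoc_conformalW :> conformal m;
  conformal_assoc : forall x y z,
    ext m lam (cst x) (ext m mu (cst y) (cst z)) =
    ext m lam_mu (ext m lam (cst x) (cst y)) (cst z)
}.

Record lie_conformal br : Prop := LieConformal {
  lie_conformalW :> conformal br;
  lie_skew : forall x y,
    ext br lam (cst x) (cst y) = - ext br neg_lam_d (cst y) (cst x);
  lie_jacobi : forall x y z,
    ext br lam (cst x) (ext br mu (cst y) (cst z)) =
      ext br lam_mu (ext br lam (cst x) (cst y)) (cst z)
      + ext br mu (cst y) (ext br lam (cst x) (cst z))
}.

Record noncomm_TPCA br op : Prop := NoncommTPCA {
  TPCA_lie : lie_conformal br;
  TPCA_assoc : assoc_conformal op;
  TPCA_leibniz : forall x y z,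
    ext op lam (cst x) (ext br mu (cst y) (cst z)) *+ 2 =
      ext br lam_mu (ext op lam (cst x) (cst y)) (cst z)
      + ext br mu (cst y) (ext op lam (cst x) (cst z))
}.

Definition nontrivial op : Prop := exists x y, op x y <> 0.

End ConformalAlgebras.

Definition TPCA_iso (K : fieldType) (A B : lmodType {poly K})
    (br op : lambda_product A) (br' op' : lambda_product B) : Prop :=
  exists phi : {linear A -> B},
    [/\ bijective phi,
        forall x y, map_coef phi (br x y) = br' (phi x) (phi y)
      & forall x y, map_coef phi (op x y) = op' (phi x) (phi y)].

(* The carrier of W(a, b), the free K[d]-module on L = genL and M = genM.    *)
Notation Wmod K := 'rV[{poly K}]_2.

Section Wab.
Variable K : fieldType.

Definition genL : Wmod K := delta_mx 0 0.
Definition genM : Wmod K := delta_mx 0 1.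

(* p(d, lambda) w, where p in K[d][lambda] has inner variable d and outer     *)
(* variable lambda *)
Definition dlscale (p : {poly {poly K}}) (w : Wmod K) : {malg (Wmod K)[nat]} :=
  \sum_(n < size p) << p`_n *: w *g (n : nat) >>.

Definition dvar : {poly {poly K}} := 'X%:P.
Definition lvar : {poly {poly K}} := 'X.

(* By sesquilinearity [(f u)_lambda (g v)] is f(-lambda) g(d + lambda) times  *)
(* [u_lambda v] for f, g in K[d]; by skew-symmetry [M_lambda L] is            *)
(* - [L_{-lambda-d} M] = ((a - 1) d + a lambda - b) M.                        *)
Definition W_bracket (a b : K) : lambda_product (Wmod K) := fun x y =>
  let neg (f : {poly K}) := f^:P \Po (- lvar) in
  let pos (f : {poly K}) := f^:P \Po (dvar + lvar) in
  let a' := a%:P%:P in let b' := b%:P%:P in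
  let x_L := x 0 0 in let x_M := x 0 1 in
  let y_L := y 0 0 in let y_M := y 0 1 in
  dlscale (neg x_L * pos y_L * (dvar + 2 * lvar)) genL
  + dlscale (neg x_L * pos y_M * (dvar + a' * lvar + b')
           + neg x_M * pos y_L * ((a' - 1) * dvar + a' * lvar - b')) genM.

Definition products_on_generators (op : lambda_product (Wmod K))
    (LL LM ML MM : {malg (Wmod K)[nat]}) : Prop :=
  [/\ op genL genL = LL, op genL genM = LM,
      op genM genL = ML & op genM genM = MM].

End Wab.

Arguments genL {K}.
Arguments genM {K}.

(* Main.v *)
Require Import Defs.
From HB Require Import structures.
From mathcomp Require Import all_boot all_order all_algebra.
From mathcomp Require Import reals complex monalg.
From mathcomp Require Import finmap ring.

Set Implicit Arguments.
Unset Strict Implicit.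
Unset Printing Implicit Defensive.

Import GRing.Theory Num.Theory.
Local Open Scope ring_scope.

(** By the Leibniz rule with the factor 2, a left multiplication x o_ of a
    noncommutative TPCA is a conformal 1/2-derivation of its Lie conformal algebra.
    W(a, b) has very few of these: none but zero unless a = 2, and for a = 2 only
    L |-> f(lambda) L + g(lambda) M, M |-> f(lambda) M ([half_derivation]). So the
    whole product is given by four polynomials in lambda, (f1, g1) for L o_ and
    (f2, g2) for M o_. Associativity becomes a system of functional equations for
    them, with four families of solutions ([associative_tables]).

    For a = 2 the bracket is preserved by the changes of basis
    L |-> L + p (d - b) M, M |-> c M with p, c constants and c nonzero
    ([base_change_bracket]). A suitable one brings each solution to a normal form;
    one of the four families splits in two, according to whether the coefficient of
    M in L o L vanishes or can be scaled to 1 ([normal_form]).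

    All computations are made with numbers. Since the field is infinite, an
    identity between polynomials in lambda, mu and the derivation d is the same as
    the identity between all their values. At lambda = t, sesquilinearity says that
    a coefficient p(d) in the left factor of a product comes out as p(- t), and in
    the right factor as p(d + t). This turns the formal substitutions in the axioms
    into plain substitutions of numbers, in finite sums over the generators
    ([assoc_ev], [leibniz_ev]). *)

(** * Transport of structure *)

Section MapCoef.
Variables (K : fieldType) (A B : lmodType {poly K}) (I : nmodType).
Variable h : A -> B.
Hypothesis h0 : h 0 = 0.

Lemma map_coefE (P : {malg A[I]}) u : (map_coef h P)@_u = h P@_u.
Proof.
rewrite /map_coef raddf_sum /=.
under eq_bigr do rewrite mcoeffU.
case: (msuppP P u) => [hu|hu]; first last.
  rewrite h0 big_seq big1 // => v hv.
  by case: eqP => // vu; rewrite -vu hv in hu.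
rewrite (big_rem u) //= eqxx mulr1n big_seq big1 ?addr0 // => v hv.
case: eqP => // vu; move: hv; rewrite vu (rem_filter _ (fset_uniq _)).
by rewrite mem_filter /= eqxx.
Qed.

End MapCoef.

Section Transport.
Variables (K : fieldType) (A B : lmodType {poly K}) (phi : {linear A -> B}).
Hypothesis phi_inj : injective phi.

Let phi0 : phi 0 = 0. Proof. exact: raddf0. Qed.

Section Exponents.
Variable I : nmodType.
Implicit Types P Q : {malg A[I]}.

Lemma map_coefD P Q : map_coef phi (P + Q) = map_coef phi P + map_coef phi Q.
Proof. by apply/malgP => u; rewrite !mcoeffD !map_coefE // mcoeffD raddfD. Qed.

Lemma map_coef0 : map_coef phi (0 : {malg A[I]}) = 0.
Proof. by apply/malgP => u; rewrite map_coefE // !mcoeff0. Qed.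

Lemma map_coefN P : map_coef phi (- P) = - map_coef phi P.
Proof. by apply/malgP => u; rewrite mcoeffN !map_coefE // mcoeffN raddfN. Qed.

Lemma map_coef_sum (T : Type) (r : seq T) (F : T -> {malg A[I]}) :
  map_coef phi (\sum_(i <- r) F i) = \sum_(i <- r) map_coef phi (F i).
Proof. exact: (big_morph _ map_coefD map_coef0). Qed.

Lemma map_coefU x (u : I) : map_coef phi << x *g u >> = << phi x *g u >>.
Proof.
by apply/malgP => v; rewrite map_coefE // !mcoeffU; case: eqP; rewrite ?raddf0.
Qed.

Lemma msupp_map_coef P : msupp (map_coef phi P) = msupp P.
Proof.
apply/fsetP => u; rewrite -!mcoeff_neq0 map_coefE //.
by rewrite -(inj_eq phi_inj) phi0.
Qed.

Lemma map_coef_shift u P : map_coef phi (shift u P) = shift u (map_coef phi P).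
Proof.
rewrite /shift map_coef_sum msupp_map_coef.
by apply: eq_bigr => v _; rewrite map_coefU map_coefE.
Qed.

Lemma map_coef_dmul P : map_coef phi (dmul P) = dmul (map_coef phi P).
Proof.
by apply/malgP => u; rewrite !(map_coefE, scaler0) // linearZ.
Qed.

Lemma map_coef_scale c P :
  map_coef phi (map_coef (fun w => c *: w) P) =
  map_coef (fun w => c *: w) (map_coef phi P).
Proof.
by apply/malgP => u; rewrite !(map_coefE, scaler0) // linearZ.
Qed.

End Exponents.

Section Ext.
Variable I : nmodType.
Implicit Types P Q : {malg A[I]}.
Variables (thA : {malg A[I]} -> {malg A[I]}) (thB : {malg B[I]} -> {malg B[I]}).
Hypothesis phi_th : forall P, map_coef phi (thA P) = thB (map_coef phi P).

Lemma map_coef_subst w :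
  map_coef phi (subst thA w) = subst thB (map_coef phi w).
Proof.
rewrite /subst map_coef_sum msupp_map_coef; apply: eq_bigr => n _.
rewrite map_coefE // -map_coefU.
by move: (w@_n) => x; elim: (n : nat) => //= k <-.
Qed.

Variables (mA : lambda_product A) (mB : lambda_product B).
Hypothesis phi_m : forall x y, map_coef phi (mA x y) = mB (phi x) (phi y).

(** All the identities of the theory are built from [ext], so naturality of [ext]
    is what carries them from A to B. Injectivity of phi keeps the supports over
    which [ext] sums unchanged. *)
Lemma map_coef_ext P Q :
  map_coef phi (ext mA thA P Q) =
  ext mB thB (map_coef phi P) (map_coef phi Q).
Proof.
rewrite /ext map_coef_sum msupp_map_coef; apply: eq_bigr => u _.
rewrite map_coef_sum msupp_map_coef; apply: eq_bigr => v _.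
by rewrite map_coef_shift map_coef_subst phi_m !map_coefE.
Qed.

End Ext.

Lemma map_coef_cst x : map_coef phi (cst x) = cst (phi x).
Proof. exact: map_coefU. Qed.

Lemma map_coef_lam P : map_coef phi (lam P) = lam (map_coef phi P).
Proof. exact: map_coef_shift. Qed.

Lemma map_coef_mu P : map_coef phi (mu P) = mu (map_coef phi P).
Proof. exact: map_coef_shift. Qed.

Lemma map_coef_lam_mu P : map_coef phi (lam_mu P) = lam_mu (map_coef phi P).
Proof. by rewrite map_coefD map_coef_lam map_coef_mu. Qed.

Variable psi : B -> A.
Hypothesis psiK : cancel psi phi.
Hypothesis phiK : cancel phi psi.

Let lin_psi c x y : psi (c *: x + y) = c *: psi x + psi y.
Proof. by apply: phi_inj; rewrite psiK linearP !psiK. Qed.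

Let psiZ c x : psi (c *: x) = c *: psi x.
Proof. by apply: phi_inj; rewrite psiK linearZ /= psiK. Qed.

Variables (brA opA : lambda_product A) (brB : lambda_product B).
Hypothesis phi_br : forall x y, map_coef phi (brA x y) = brB (phi x) (phi y).

Section Identities.
Variables (I : nmodType).
Variables (lA mA lmA : {malg A[I]} -> {malg A[I]}).
Variables (lB mB lmB : {malg B[I]} -> {malg B[I]}).
Hypothesis phi_l : forall P, map_coef phi (lA P) = lB (map_coef phi P).
Hypothesis phi_m : forall P, map_coef phi (mA P) = mB (map_coef phi P).
Hypothesis phi_lm : forall P, map_coef phi (lmA P) = lmB (map_coef phi P).
Variable opB : lambda_product B.
Hypothesis phi_op : forall x y, map_coef phi (opA x y) = opB (phi x) (phi y).

(** The substitutions for lambda, mu and lambda + mu enter only through their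
    compatibility with phi. *)
Lemma map_coef_assoc P Q S :
  ext opA lA P (ext opA mA Q S) = ext opA lmA (ext opA lA P Q) S ->
  ext opB lB (map_coef phi P) (ext opB mB (map_coef phi Q) (map_coef phi S)) =
  ext opB lmB (ext opB lB (map_coef phi P) (map_coef phi Q)) (map_coef phi S).
Proof.
move=> h.
have l := etrans (map_coef_ext phi_l phi_op P (ext opA mA Q S))
  (congr1 (ext opB lB (map_coef phi P)) (map_coef_ext phi_m phi_op Q S)).
have r := etrans (map_coef_ext phi_lm phi_op (ext opA lA P Q) S)
  (congr1 (fun T => ext opB lmB T (map_coef phi S))
     (map_coef_ext phi_l phi_op P Q)).
exact: etrans (esym l) (etrans (congr1 (map_coef phi) h) r).
Qed.

Lemma map_coef_leibniz P Q S :
  ext opA lA P (ext brA mA Q S) *+ 2 =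
  ext brA lmA (ext opA lA P Q) S + ext brA mA Q (ext opA lA P S) ->
  ext opB lB (map_coef phi P) (ext brB mB (map_coef phi Q) (map_coef phi S))
    *+ 2 =
  ext brB lmB (ext opB lB (map_coef phi P) (map_coef phi Q)) (map_coef phi S)
  + ext brB mB (map_coef phi Q) (ext opB lB (map_coef phi P) (map_coef phi S)).
Proof.
move=> h.
have l := etrans (map_coef_ext phi_l phi_op P (ext brA mA Q S))
  (congr1 (ext opB lB (map_coef phi P)) (map_coef_ext phi_m phi_br Q S)).
have r1 := etrans (map_coef_ext phi_lm phi_br (ext opA lA P Q) S)
  (congr1 (fun T => ext brB lmB T (map_coef phi S))
     (map_coef_ext phi_l phi_op P Q)).
have r2 := etrans (map_coef_ext phi_m phi_br Q (ext opA lA P S))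
  (congr1 (ext brB mB (map_coef phi Q)) (map_coef_ext phi_l phi_op P S)).
rewrite mulr2n in h.
have d := etrans (congr1 (map_coef phi) h) (map_coefD _ _).
rewrite mulr2n.
exact: etrans (esym (etrans (map_coefD _ _) (congr2 +%R l l)))
  (etrans d (congr2 +%R r1 r2)).
Qed.

End Identities.

(** The structure on B that makes phi, with inverse psi, an isomorphism. *)
Definition transport : lambda_product B :=
  fun x y => map_coef phi (opA (psi x) (psi y)).

Lemma transportE x y : map_coef phi (opA x y) = transport (phi x) (phi y).
Proof. by rewrite /transport !phiK. Qed.

Lemma transport_conformal : conformal opA -> conformal transport.
Proof.
case=> linl linr dl dr; rewrite /transport; split=> [c x y z|c x y z|x y|x y].
- by rewrite lin_psi linl map_coefD map_coef_scale.
- by rewrite lin_psi linr map_coefD map_coef_scale.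
- by rewrite psiZ dl map_coefN /lambda1 map_coef_shift.
- by rewrite psiZ dr map_coefD /lambda1 map_coef_shift map_coef_dmul.
Qed.

Lemma transport_TPCA :
  lie_conformal brB -> noncomm_TPCA brA opA -> noncomm_TPCA brB transport.
Proof.
move=> lieB [lieA [confA assA] leibA].
apply: (NoncommTPCA lieB); first apply: AssocConformal.
- exact: transport_conformal.
- move=> x y z; rewrite -[x]psiK -[y]psiK -[z]psiK -!map_coef_cst.
  apply: map_coef_assoc (assA _ _ _); first exact: map_coef_lam.
  + exact: map_coef_mu.
  + exact: map_coef_lam_mu.
  + exact: transportE.
- move=> x y z; rewrite -[x]psiK -[y]psiK -[z]psiK -!map_coef_cst.
  apply: map_coef_leibniz (leibA _ _ _); first exact: map_coef_lam.
  + exact: map_coef_mu.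
  + exact: map_coef_lam_mu.
  + exact: transportE.
Qed.

End Transport.

(** * Evaluation at numbers *)

Section Evaluation.
Variables (K : fieldType) (n : nat).
Local Notation A := 'rV[{poly K}]_n.

(** The [j]-th coordinate at the value [d] of the derivation variable. *)
Definition coord (d : K) (j : 'I_n) (x : A) : K := (x 0 j).[d].

Fact coord_is_additive d j : {morph coord d j : x y / x - y}.
Proof. by move=> x y; rewrite /coord !mxE hornerD hornerN. Qed.

HB.instance Definition _ d j :=
  GRing.isZmodMorphism.Build A K (coord d j) (coord_is_additive d j).

Lemma coordZ d j p x : coord d j (p *: x) = p.[d] * coord d j x.
Proof. by rewrite /coord mxE hornerM. Qed.

(** Values of a polynomial in formal variables: [chi u] is the value of the
    monomial with exponent [u]. *)
Definition ev (I : choiceType) (chi : I -> K) d j (P : {malg A[I]}) : K :=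
  mmap (coord d j) chi P.

Section Exponents.
Variables (I : nmodType) (chi : I -> K) (d : K) (j : 'I_n).
Implicit Types P Q : {malg A[I]}.
Local Notation E := (ev chi d j).

Lemma evD P Q : E (P + Q) = E P + E Q. Proof. exact: mmapD. Qed.
Lemma evN P : E (- P) = - E P. Proof. exact: mmapN. Qed.
Lemma evMn P k : E (P *+ k) = E P *+ k. Proof. exact: mmapMn. Qed.
Lemma ev0 : E 0 = 0. Proof. exact: mmap0. Qed.
Lemma evU x u : E << x *g u >> = chi u * coord d j x.
Proof. by rewrite /ev mmapU mulrC. Qed.
Lemma ev_sum (T : Type) (r : seq T) (F : T -> {malg A[I]}) :
  E (\sum_(i <- r) F i) = \sum_(i <- r) E (F i).
Proof. exact: (big_morph _ evD ev0). Qed.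
Lemma evE P : E P = \sum_(u <- msupp P) chi u * coord d j P@_u.
Proof. by rewrite /ev mmapE; apply: eq_bigr => u _; rewrite mulrC. Qed.

Lemma ev_map_coef h P :
  E (map_coef h P) = \sum_(u <- msupp P) chi u * coord d j (h P@_u).
Proof. by rewrite ev_sum; apply: eq_bigr => u _; rewrite evU. Qed.

Lemma ev_scale p P : E (map_coef (fun w => p *: w) P) = p.[d] * E P.
Proof.
rewrite ev_map_coef evE big_distrr /=; apply: eq_bigr => u _.
by rewrite coordZ mulrCA.
Qed.

Lemma ev_dmul P : E (dmul P) = d * E P.
Proof. by rewrite ev_scale hornerX. Qed.

Hypothesis chiD : forall u v, chi (u + v) = chi u * chi v.

Lemma ev_shift u P : E (shift u P) = chi u * E P.
Proof.
rewrite [in RHS]evE ev_sum big_distrr /=; apply: eq_bigr => v _.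
by rewrite evU chiD mulrA.
Qed.

End Exponents.

(** The value at lambda = [t]. *)
Definition evl (t : K) := ev (fun k : nat => t ^+ k).

Lemma evl_ev t d j w : evl t d j w = ev (fun k : nat => t ^+ k) d j w.
Proof. by []. Qed.

Lemma evl_lambda1 t d j w : evl t d j (lambda1 w) = t * evl t d j w.
Proof. by rewrite !evl_ev ev_shift // => u v; rewrite exprD. Qed.

Lemma evlD t d j v w : evl t d j (v + w) = evl t d j v + evl t d j w.
Proof. by rewrite !evl_ev; exact: evD. Qed.

Lemma evlN t d j w : evl t d j (- w) = - evl t d j w.
Proof. by rewrite !evl_ev; exact: evN. Qed.

Lemma evl_dmul t d j w : evl t d j (dmul w) = d * evl t d j w.
Proof. by rewrite !evl_ev; exact: ev_dmul. Qed.

Section Product.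
Variable m : lambda_product A.
Hypothesis conf : conformal m.
Variables (t d : K) (k : 'I_n).

Local Notation mv x y := (evl t d k (m x y)).

Let linl c x y z : mv (c%:P *: x + y) z = c * mv x z + mv y z.
Proof. by rewrite (conformal_linl conf) evlD !evl_ev ev_scale hornerC. Qed.

Let linr c x y z : mv x (c%:P *: y + z) = c * mv x y + mv x z.
Proof. by rewrite (conformal_linr conf) evlD !evl_ev ev_scale hornerC. Qed.

Let addl x y z : mv (x + y) z = mv x z + mv y z.
Proof. by have := linl 1 x y z; rewrite scale1r mul1r. Qed.

Let addr x y z : mv x (y + z) = mv x y + mv x z.
Proof. by have := linr 1 x y z; rewrite scale1r mul1r. Qed.

Let zerol y : mv 0 y = 0.
Proof. by apply: (addrI (mv 0 y)); rewrite -addl !addr0. Qed.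

Let zeror x : mv x 0 = 0.
Proof. by apply: (addrI (mv x 0)); rewrite -addr !addr0. Qed.

(** Sesquilinearity: in the left factor the derivation acts as - lambda, in the
    right factor as d + lambda. *)
Lemma evl_scalel p x y : mv (p *: x) y = p.[- t] * mv x y.
Proof.
elim/poly_ind: p => [|p c IH]; first by rewrite scale0r zerol horner0 mul0r.
rewrite hornerMXaddC scalerDl [in LHS]addrC linl (mulrC p) -scalerA.
rewrite (conformal_dl conf) evlN evl_lambda1 IH; ring.
Qed.

Lemma evl_scaler p x y : mv x (p *: y) = p.[d + t] * mv x y.
Proof.
elim/poly_ind: p => [|p c IH]; first by rewrite scale0r zeror horner0 mul0r.
rewrite hornerMXaddC scalerDl [in LHS]addrC linr (mulrC p) -scalerA.
rewrite (conformal_dr conf) evlD evl_dmul evl_lambda1 IH; ring.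
Qed.

Local Notation e i := (delta_mx 0 i : A).

Lemma evl_suml x y : mv x y = \sum_i coord (- t) i x * mv (e i) y.
Proof.
rewrite [in LHS](row_sum_delta x).
rewrite (big_morph (fun x => mv x y) (fun u v => addl u v y) (zerol y)).
by apply: eq_bigr => i _; rewrite evl_scalel.
Qed.

Lemma evl_sumr x y : mv x y = \sum_j coord (d + t) j y * mv x (e j).
Proof.
rewrite [in LHS](row_sum_delta y) (big_morph _ (addr x) (zeror x)).
by apply: eq_bigr => i _; rewrite evl_scaler.
Qed.

(* The operator theta is only known through its value: it acts as the number t on
   the k-th coordinate at d. *)
Section Ext.
Variables (I : nmodType) (chi : I -> K) (theta : {malg A[I]} -> {malg A[I]}).
Hypothesis chi0 : chi 0 = 1.
Hypothesis chiD : forall u v, chi (u + v) = chi u * chi v.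
Hypothesis ev_theta : forall P, ev chi d k (theta P) = t * ev chi d k P.

Lemma ev_subst w : ev chi d k (subst theta w) = evl t d k w.
Proof.
rewrite ev_sum evl_ev evE; apply: eq_bigr => i _.
move: (w@_i) => x; elim: (i : nat) => [|l IH] /=; first by rewrite evU chi0.
by rewrite ev_theta IH exprS mulrA.
Qed.

Lemma ev_ext P Q :
  ev chi d k (ext m theta P Q) =
  \sum_(u <- msupp P) \sum_(v <- msupp Q) chi u * chi v * mv P@_u Q@_v.
Proof.
rewrite ev_sum; apply: eq_bigr => u _; rewrite ev_sum; apply: eq_bigr => v _.
by rewrite ev_shift // chiD ev_subst.
Qed.

(** The coefficients of P are moved out of the left factor, where the derivation
    has the value - t; so P itself is evaluated at - t. *)
Lemma ev_extUr P z :
  ev chi d k (ext m theta P << z *g 0 >>) =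
  \sum_i ev chi (- t) i P * mv (e i) z.
Proof.
rewrite ev_ext.
transitivity (\sum_(u <- msupp P) chi u * mv P@_u z).
  apply: eq_bigr => u _; rewrite msuppU; case: eqP => [->|_].
    by rewrite big_seq_fset0 zeror mulr0.
  by rewrite big_seq_fset1 mcoeffUU chi0 mulr1.
under eq_bigr do rewrite evl_suml big_distrr.
rewrite exchange_big; apply: eq_bigr => i _.
by rewrite evE big_distrl; apply: eq_bigr => u _; rewrite /= mulrA.
Qed.

(** The coefficients of Q are moved out of the right factor, where the derivation
    has the value d + t; so Q itself is evaluated at d + t. *)
Lemma ev_extUl x Q :
  ev chi d k (ext m theta << x *g 0 >> Q) =
  \sum_j ev chi (d + t) j Q * mv x (e j).
Proof.
rewrite ev_ext.
transitivity (\sum_(v <- msupp Q) chi v * mv x Q@_v).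
  rewrite msuppU; case: eqP => [->|_].
    by rewrite big_seq_fset0 big1 // => v _; rewrite zerol mulr0.
  by rewrite big_seq_fset1; apply: eq_bigr => v _; rewrite mcoeffUU chi0 mul1r.
under eq_bigr do rewrite evl_sumr big_distrr.
rewrite exchange_big; apply: eq_bigr => i _.
by rewrite evE big_distrl; apply: eq_bigr => u _; rewrite /= mulrA.
Qed.

Lemma ev_extUU x z :
  ev chi d k (ext m theta << x *g 0 >> << z *g 0 >>) = mv x z.
Proof.
rewrite ev_extUl evl_sumr; apply: eq_bigr => i _.
by rewrite evU chi0 mul1r.
Qed.

End Ext.

End Product.
End Evaluation.

(** * Associativity and the Leibniz rule as numerical identities *)

Section Identities.
Variables (K : fieldType) (n : nat).
Local Notation A := 'rV[{poly K}]_n.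
Local Notation e i := (delta_mx 0 i : A).

Definition bipow (l m : K) (u : nat * nat) : K := l ^+ u.1 * m ^+ u.2.

Lemma bipowD l m u v : bipow l m (u + v) = bipow l m u * bipow l m v.
Proof. by rewrite /bipow /= !exprD mulrACA. Qed.

Lemma ev_lam l m d j (P : {malg A[(nat * nat)%type]}) :
  ev (bipow l m) d j (lam P) = l * ev (bipow l m) d j P.
Proof. by rewrite ev_shift; [rewrite /bipow mulr1|exact: bipowD]. Qed.

Lemma ev_mu l m d j (P : {malg A[(nat * nat)%type]}) :
  ev (bipow l m) d j (mu P) = m * ev (bipow l m) d j P.
Proof. by rewrite ev_shift; [rewrite /bipow mul1r|exact: bipowD]. Qed.

Lemma ev_lam_mu l m d j (P : {malg A[(nat * nat)%type]}) :
  ev (bipow l m) d j (lam_mu P) = (l + m) * ev (bipow l m) d j P.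
Proof. by rewrite mulrDl -ev_lam -ev_mu; exact: evD. Qed.

Section TwoProducts.
Variables (m1 m2 : lambda_product A).
Hypotheses (conf1 : conformal m1) (conf2 : conformal m2).
Variables (th1 th2 : {malg A[(nat * nat)%type]} -> {malg A[(nat * nat)%type]}).
Variables (l m t1 t2 : K).
Hypothesis ev_th1 :
  forall d k P, ev (bipow l m) d k (th1 P) = t1 * ev (bipow l m) d k P.
Hypothesis ev_th2 :
  forall d k P, ev (bipow l m) d k (th2 P) = t2 * ev (bipow l m) d k P.
Variables (d : K) (k : 'I_n).

Let bipow0 : bipow l m 0 = 1. Proof. by rewrite /bipow mulr1. Qed.
Let bipowM u v := bipowD l m u v.

Lemma ev_ext_right x y z :
  ev (bipow l m) d k (ext m1 th1 (cst x) (ext m2 th2 (cst y) (cst z))) =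
  \sum_j evl t2 (d + t1) j (m2 y z) * evl t1 d k (m1 x (e j)).
Proof.
apply: etrans (ev_extUl conf1 bipow0 bipowM (ev_th1 d k) x _) _.
apply: eq_bigr => j _; congr (_ * _).
exact: (ev_extUU conf2 bipow0 bipowM (ev_th2 _ j)).
Qed.

Lemma ev_ext_left x y z :
  ev (bipow l m) d k (ext m1 th1 (ext m2 th2 (cst x) (cst y)) (cst z)) =
  \sum_i evl t2 (- t1) i (m2 x y) * evl t1 d k (m1 (e i) z).
Proof.
apply: etrans (ev_extUr conf1 bipow0 bipowM (ev_th1 d k) _ z) _.
apply: eq_bigr => j _; congr (_ * _).
exact: (ev_extUU conf2 bipow0 bipowM (ev_th2 _ j)).
Qed.

End TwoProducts.

Variables (br op : lambda_product A).
Hypothesis hop : noncomm_TPCA br op.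

Let conf_br : conformal br. Proof. by case: hop => -[]. Qed.
Let conf_op : conformal op. Proof. by case: hop => _ []. Qed.

Lemma assoc_ev l m d k x y z :
  \sum_j evl m (d + l) j (op y z) * evl l d k (op x (e j)) =
  \sum_i evl l (- (l + m)) i (op x y) * evl (l + m) d k (op (e i) z).
Proof.
have [_ [_ /(_ x y z) h] _] := hop.
have L := ev_ext_right conf_op conf_op (ev_lam l m) (ev_mu l m) d k x y z.
apply: etrans (esym L) _.
apply: etrans (congr1 (ev (bipow l m) d k) h) _.
exact: (ev_ext_left conf_op conf_op (ev_lam_mu l m) (ev_lam l m) d k x y z).
Qed.

Lemma leibniz_ev l m d k x y z :
  2 * (\sum_j evl m (d + l) j (br y z) * evl l d k (op x (e j))) =
  \sum_i evl l (- (l + m)) i (op x y) * evl (l + m) d k (br (e i) z)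
  + \sum_j evl l (d + m) j (op x z) * evl m d k (br y (e j)).
Proof.
have [_ _ /(_ x y z) h] := hop.
have L := ev_ext_right conf_op conf_br (ev_lam l m) (ev_mu l m) d k x y z.
have R1 := ev_ext_left conf_br conf_op (ev_lam_mu l m) (ev_lam l m) d k x y z.
have R2 := ev_ext_right conf_br conf_op (ev_mu l m) (ev_lam l m) d k y x z.
rewrite mulr_natl.
apply: etrans (congr1 (fun c => c *+ 2) (esym L)) _.
apply: etrans (esym (evMn _ _ _ _ _)) _.
apply: etrans (congr1 (ev (bipow l m) d k) h) _.
exact: etrans (evD _ _ _ _ _) (congr2 +%R R1 R2).
Qed.

End Identities.

(** * Recovering polynomials from their values *)

Section PolynomialFunctions.
Variable K : numFieldType.
Implicit Types p q : {poly K}.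

Lemma poly_fun0 p : (forall x, p.[x] = 0) -> p = 0.
Proof.
move=> p0; apply/eqP; apply: contraT => /max_poly_roots.
move/(_ [seq i%:R | i <- iota 0 (size p)]).
rewrite size_map size_iota ltnn => -> //.
  by apply/allP => x _; apply/rootP.
by rewrite map_inj_uniq ?iota_uniq //; exact: Num.Theory.mulrIn (oner_neq0 _).
Qed.

Lemma poly_fun_inj p q : (forall x, p.[x] = q.[x]) -> p = q.
Proof.
move=> pq; apply/eqP; rewrite -subr_eq0; apply/eqP/poly_fun0 => x.
by rewrite hornerD hornerN pq subrr.
Qed.

(** Multiplying by ['X - x0] removes the exceptional point. This is how all the
    linear factors of the functional equations below are cancelled. *)
Lemma poly_fun_off p c x0 :
  (forall x, x != x0 -> p.[x] = c) -> forall x, p.[x] = c.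
Proof.
move=> h x; suff /eqP : (p - c%:P) * ('X - x0%:P) = 0.
  rewrite mulf_eq0 polyXsubC_eq0 orbF subr_eq0 => /eqP ->.
  by rewrite hornerC.
apply: poly_fun0 => y; rewrite !hornerE.
by case: (eqVneq y x0) => [->|/h ->]; rewrite subrr ?mulr0 ?mul0r.
Qed.

(** Additivity gives p(2 x) = 2 p(x), hence 2 ^ i p_i = 2 p_i on coefficients. *)
Lemma additive_poly p :
  (forall x y, p.[x + y] = p.[x] + p.[y]) -> p = p`_1 *: 'X.
Proof.
move=> h; pose q := \poly_(i < size p) (p`_i * 2 ^+ i).
have q2 : q = 2%:P * p.
  apply: poly_fun_inj => x; rewrite hornerM hornerC mulr_natl mulr2n -h.
  rewrite -mulr2n -mulr_natl horner_poly horner_coef.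
  by apply: eq_bigr => i _; rewrite exprMn mulrA.
apply/polyP => i; rewrite coefZ coefX.
have [->|i1] := eqVneq i 1%N; first by rewrite mulr1.
have : q`_i = p`_i * 2 ^+ i.
  rewrite coef_poly; case: ltnP => // hi.
  by rewrite nth_default // mul0r.
rewrite q2 coefCM mulr0 => /eqP; rewrite mulrC -subr_eq0 -mulrBr mulf_eq0.
case/orP => [/eqP //|]; rewrite subr_eq0 -natrX eqr_nat.
by rewrite (eqn_exp2l 1) // eq_sym (negPf i1).
Qed.

Variable n : nat.
Implicit Types w v : {malg 'rV[{poly K}]_n[nat]}.

Lemma evl_poly_lambda d j w : {p | forall t, evl t d j w = p.[t]}.
Proof.
exists (\sum_(k <- msupp w) coord d j w@_k *: 'X^k) => t.
rewrite evl_ev evE horner_sum; apply: eq_bigr => k _.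
by rewrite !hornerE mulrC.
Qed.

Lemma evl_poly_d t j w : {p | forall d, evl t d j w = p.[d]}.
Proof.
exists (\sum_(k <- msupp w) t ^+ k *: (w@_k 0 j)) => d.
by rewrite evl_ev evE horner_sum; apply: eq_bigr => k _; rewrite hornerZ.
Qed.

Lemma evl_off_d d0 t j c w :
  (forall d, d != d0 -> evl t d j w = c) -> forall d, evl t d j w = c.
Proof.
have [p wp] := evl_poly_d t j w.
by move=> h d; rewrite wp; apply: (@poly_fun_off p c d0) => x /h; rewrite wp.
Qed.

Lemma evl_off_lambda t0 d j c w :
  (forall t, t != t0 -> evl t d j w = c) -> forall t, evl t d j w = c.
Proof.
have [p wp] := evl_poly_lambda d j w.
by move=> h t; rewrite wp; apply: (@poly_fun_off p c t0) => x /h; rewrite wp.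
Qed.

(** Over an infinite field a polynomial in lambda with coefficients in the free
    module is determined by its values. *)
Lemma evl_inj v w : (forall t d j, evl t d j v = evl t d j w) -> v = w.
Proof.
move=> vw; apply/malgP => i; apply/rowP => j.
apply: poly_fun_inj => d; rewrite -/(coord d j _) -/(coord d j w@_i).
have coef u : (\sum_(k <- msupp u) coord d j u@_k *: 'X^k)`_i = coord d j u@_i.
  rewrite coef_sum [in RHS](monalgE u) !raddf_sum /=; apply: eq_bigr => k _.
  rewrite coefZ coefXn mcoeffU eq_sym.
  by case: eqP; rewrite ?mulr1 ?mulr0 ?raddf0.
rewrite -!coef; apply: (congr1 (fun p : {poly K} => p`_i)).
apply: poly_fun_inj => t.
have ev u : (\sum_(k <- msupp u) coord d j u@_k *: 'X^k).[t] = evl t d j u.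
  rewrite evl_ev evE horner_sum; apply: eq_bigr => k _.
  by rewrite !hornerE mulrC.
by rewrite !ev vw.
Qed.

End PolynomialFunctions.

(** * Rank two and the bracket of W(a, b) *)

Lemma sum_ord2 (K : nmodType) (F : 'I_2 -> K) : \sum_i F i = F 0 + F 1.
Proof.
rewrite !big_ord_recl big_ord0 addr0; congr (_ + F _); exact: val_inj.
Qed.

Section Bracket.
Variable K : fieldType.

Lemma evl_dlscale t d j (p : {poly {poly K}}) (w : Wmod K) :
  evl t d j (dlscale p w) = p.[t%:P].[d] * coord d j w.
Proof.
rewrite evl_ev ev_sum (horner_coef p) horner_sum big_distrl /=.
apply: eq_bigr => i _; rewrite evU coordZ hornerM -polyC_exp hornerC.
by rewrite mulrA (mulrC (t ^+ i)).
Qed.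

Lemma coord_genL d : (coord d 0 (genL : Wmod K) = 1) *
  (coord d 1 (genL : Wmod K) = 0).
Proof. by split; rewrite /coord !mxE /= (hornerC, horner0). Qed.

Lemma coord_genM d : (coord d 0 (genM : Wmod K) = 0) *
  (coord d 1 (genM : Wmod K) = 1).
Proof. by split; rewrite /coord !mxE /= (hornerC, horner0). Qed.

Let neg_eval (f : {poly K}) (t d : K) : (f^:P \Po (- 'X)).[t%:P].[d] = f.[- t].
Proof.
by rewrite horner_comp hornerN hornerX -polyCN horner_map /= hornerC.
Qed.

Let pos_eval (f : {poly K}) (t d : K) :
  (f^:P \Po ('X%:P + 'X)).[t%:P].[d] = f.[d + t].
Proof.
rewrite horner_comp hornerD hornerX hornerC -/(comp_poly _ _) horner_comp.
by rewrite hornerD hornerX hornerC.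
Qed.

Lemma evl_bracketL (a b t d : K) (x y : Wmod K) :
  evl t d 0 (W_bracket a b x y) =
  coord (- t) 0 x * coord (d + t) 0 y * (d + 2 * t).
Proof.
rewrite /W_bracket evlD !evl_dlscale !(coord_genL, coord_genM).
rewrite mulr1 mulr0 addr0 !hornerM neg_eval pos_eval /dvar /lvar.
by congr (_ * _); rewrite !hornerE.
Qed.

Lemma evl_bracketM (a b t d : K) (x y : Wmod K) :
  evl t d 1 (W_bracket a b x y) =
  coord (- t) 0 x * coord (d + t) 1 y * (d + a * t + b)
  + coord (- t) 1 x * coord (d + t) 0 y * ((a - 1) * d + a * t - b).
Proof.
rewrite /W_bracket evlD !evl_dlscale !(coord_genL, coord_genM).
rewrite mulr1 mulr0 add0r !hornerD !hornerM !neg_eval !pos_eval /dvar /lvar.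
by congr (_ * _ + _ * _); rewrite !hornerE.
Qed.

End Bracket.

Lemma coord_delta (K : fieldType) n d (j i : 'I_n) :
  coord d j (delta_mx 0 i : 'rV[{poly K}]_n) = (i == j)%:R.
Proof.
by rewrite /coord mxE eqxx /= (eq_sym j); case: eqP; rewrite (hornerC, horner0).
Qed.

Section RankTwo.
Variables (K : fieldType) (br op : lambda_product (Wmod K)).
Hypothesis hop : noncomm_TPCA br op.

Lemma assoc_ev2 l m d k x y z :
  evl m (d + l) 0 (op y z) * evl l d k (op x genL)
  + evl m (d + l) 1 (op y z) * evl l d k (op x genM) =
  evl l (- (l + m)) 0 (op x y) * evl (l + m) d k (op genL z)
  + evl l (- (l + m)) 1 (op x y) * evl (l + m) d k (op genM z).
Proof.
have h := assoc_ev hop l m d k x y z.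
exact: etrans (esym (sum_ord2 _)) (etrans h (sum_ord2 _)).
Qed.

Lemma leibniz_ev2 l m d k x y z :
  2 * (evl m (d + l) 0 (br y z) * evl l d k (op x genL)
       + evl m (d + l) 1 (br y z) * evl l d k (op x genM)) =
  (evl l (- (l + m)) 0 (op x y) * evl (l + m) d k (br genL z)
   + evl l (- (l + m)) 1 (op x y) * evl (l + m) d k (br genM z))
  + (evl l (d + m) 0 (op x z) * evl m d k (br y genL)
     + evl l (d + m) 1 (op x z) * evl m d k (br y genM)).
Proof.
have h := leibniz_ev hop l m d k x y z.
pose F j := evl m (d + l) j (br y z) * evl l d k (op x (delta_mx 0 j)).
apply: etrans (congr1 ( *%R 2) (esym (sum_ord2 F))) _.
exact: etrans h (congr2 +%R (sum_ord2 _) (sum_ord2 _)).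
Qed.

Lemma evl_suml2 (m : lambda_product (Wmod K)) t d k x y :
  conformal m ->
  evl t d k (m x y) = coord (- t) 0 x * evl t d k (m genL y)
                    + coord (- t) 1 x * evl t d k (m genM y).
Proof.
by move=> conf; apply: etrans (evl_suml conf t d k x y) (sum_ord2 _).
Qed.

Lemma evl_sumr2 (m : lambda_product (Wmod K)) t d k x y :
  conformal m ->
  evl t d k (m x y) = coord (d + t) 0 y * evl t d k (m x genL)
                    + coord (d + t) 1 y * evl t d k (m x genM).
Proof.
by move=> conf; apply: etrans (evl_sumr conf t d k x y) (sum_ord2 _).
Qed.

End RankTwo.

(** * Left multiplications of W(a, b) *)

Section HalfDerivations.
Variables (K : numFieldType) (a b : K).
Local Notation br := (W_bracket a b).

Lemma bracket_LL t d :
  (evl t d 0 (br genL genL) = d + 2 * t) * (evl t d 1 (br genL genL) = 0).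
Proof.
split; [apply: etrans (evl_bracketL _ _ _ _ _ _) _
       |apply: etrans (evl_bracketM _ _ _ _ _ _) _].
all: by rewrite /genL /genM !coord_delta /= ?(mul0r, mul1r, mulr0, addr0).
Qed.

Lemma bracket_LM t d :
  (evl t d 0 (br genL genM) = 0) * (evl t d 1 (br genL genM) = d + a * t + b).
Proof.
split; [apply: etrans (evl_bracketL _ _ _ _ _ _) _
       |apply: etrans (evl_bracketM _ _ _ _ _ _) _].
all: by rewrite /genL /genM !coord_delta /= ?(mul0r, mul1r, mulr0, addr0).
Qed.

Lemma bracket_ML t d :
  (evl t d 0 (br genM genL) = 0) *
  (evl t d 1 (br genM genL) = (a - 1) * d + a * t - b).
Proof.
split; [apply: etrans (evl_bracketL _ _ _ _ _ _) _
       |apply: etrans (evl_bracketM _ _ _ _ _ _) _].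
all: by rewrite /genL /genM !coord_delta /= ?(mul0r, mul1r, mulr0, add0r).
Qed.

Lemma bracket_MM t d :
  (evl t d 0 (br genM genM) = 0) * (evl t d 1 (br genM genM) = 0).
Proof.
split; [apply: etrans (evl_bracketL _ _ _ _ _ _) _
       |apply: etrans (evl_bracketM _ _ _ _ _ _) _].
all: by rewrite /genL /genM !coord_delta /= ?(mul0r, mul1r, mulr0, addr0).
Qed.

Variable op : lambda_product (Wmod K).
Hypothesis hop : noncomm_TPCA br op.
Variable x : Wmod K.

(** The Leibniz rule at mu = 0 already determines all left multiplications. The
    values of the brackets are parameters, to be filled in for each pair of
    generators. *)
Lemma leibniz_at_mu0 l d k y z p0 p1 r0 r1 s0 s1 :
  evl 0 (d + l) 0 (br y z) = p0 -> evl 0 (d + l) 1 (br y z) = p1 ->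
  evl l d k (br genL z) = r0 -> evl l d k (br genM z) = r1 ->
  evl 0 d k (br y genL) = s0 -> evl 0 d k (br y genM) = s1 ->
  2 * (p0 * evl l d k (op x genL) + p1 * evl l d k (op x genM)) =
  (evl l (- l) 0 (op x y) * r0 + evl l (- l) 1 (op x y) * r1)
  + (evl l d 0 (op x z) * s0 + evl l d 1 (op x z) * s1).
Proof.
move=> <- <- <- <- <- <-.
by have := leibniz_ev2 hop l 0 d k x y z; rewrite !addr0.
Qed.

Let simp := (mulr0, mul0r, addr0, add0r).

Lemma half_derivation_LL0 l d :
  2 * ((d + l) * evl l d 0 (op x genL)) =
  evl l (- l) 0 (op x genL) * (d + 2 * l) + evl l d 0 (op x genL) * d.
Proof.
have := leibniz_at_mu0 (bracket_LL 0 (d + l)).1 (bracket_LL 0 (d + l)).2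
  (bracket_LL l d).1 (bracket_ML l d).1 (bracket_LL 0 d).1 (bracket_LM 0 d).1.
by rewrite !simp.
Qed.

Lemma half_derivation_LL1 l d :
  2 * ((d + l) * evl l d 1 (op x genL)) =
  evl l (- l) 1 (op x genL) * ((a - 1) * d + a * l - b)
  + evl l d 1 (op x genL) * (d + b).
Proof.
have := leibniz_at_mu0 (bracket_LL 0 (d + l)).1 (bracket_LL 0 (d + l)).2
  (bracket_LL l d).2 (bracket_ML l d).2 (bracket_LL 0 d).2 (bracket_LM 0 d).2.
by rewrite !simp.
Qed.

Lemma half_derivation_LM0 l d :
  2 * ((d + l + b) * evl l d 0 (op x genM)) = evl l d 0 (op x genM) * d.
Proof.
have := leibniz_at_mu0 (bracket_LM 0 (d + l)).1 (bracket_LM 0 (d + l)).2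
  (bracket_LM l d).1 (bracket_MM l d).1 (bracket_LL 0 d).1 (bracket_LM 0 d).1.
by rewrite !simp.
Qed.

Lemma half_derivation_LM1 l d :
  2 * ((d + l + b) * evl l d 1 (op x genM)) =
  evl l (- l) 0 (op x genL) * (d + a * l + b) + evl l d 1 (op x genM) * (d + b).
Proof.
have := leibniz_at_mu0 (bracket_LM 0 (d + l)).1 (bracket_LM 0 (d + l)).2
  (bracket_LM l d).2 (bracket_MM l d).2 (bracket_LL 0 d).2 (bracket_LM 0 d).2.
by rewrite !simp.
Qed.

Let cancel_off (c y z : K) : c != 0 -> c * y = c * z -> y = z.
Proof. by move=> c0; apply: mulfI. Qed.

(** Write x o L = F L + G M and x o M = H L + Q M, with F, G, H, Q polynomials in
    lambda and d. The Leibniz rule at mu = 0 for the pairs (L, L) and (L, M) reads,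
    with F' and G' the values of F and G at d = - lambda:

    -   (d + 2 lambda) (F - F') = 0,
    -   (d + 2 lambda - b) G = ((a - 1) d + a lambda - b) G',
    -   (d + 2 lambda + 2 b) H = 0,
    -   (d + 2 lambda + b) Q = (d + a lambda + b) F'.

    So H = 0 and F does not depend on d. Setting d to the root of the left factor
    in the second and fourth equations gives (a - 2) (lambda - b) G' = 0 and
    (a - 2) lambda F' = 0; and for a = 2 both right factors equal the left ones,
    whence Q = F' and G = G'. *)
Lemma half_derivation : exists f g : {poly K},
  (forall t d, [/\ evl t d 0 (op x genL) = f.[t], evl t d 1 (op x genL) = g.[t],
     evl t d 0 (op x genM) = 0 & evl t d 1 (op x genM) = f.[t]])
  /\ (a = 2 \/ f = 0 /\ g = 0).
Proof.
have [f f0] := evl_poly_lambda 0 0 (op x genL).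
have LL0 l d : evl l d 0 (op x genL) = f.[l].
  have FC e : evl l e 0 (op x genL) = evl l (- l) 0 (op x genL).
    apply: (evl_off_d (d0 := - (2 * l))) => {}e; rewrite -addr_eq0 => e0.
    apply: (cancel_off e0); move: (half_derivation_LL0 l e).
    move: (evl l e _ _) (evl l (- l) _ _) => F F0 h.
    by rewrite [RHS]mulrC -[RHS](addrK (F * e)) -h; ring.
  by rewrite FC -f0 FC.
have LM0 l d : evl l d 0 (op x genM) = 0.
  apply: (evl_off_d (d0 := - (2 * l + 2 * b))) => {}d; rewrite -addr_eq0 => e0.
  apply: (cancel_off e0); move: (half_derivation_LM0 l d).
  move: (evl l d _ _) => H h.
  by rewrite mulr0 -(subrr (H * d)) -{1}h; ring.
have eqQ l d : (d + 2 * l + b) * evl l d 1 (op x genM) =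
    f.[l] * (d + a * l + b).
  move: (half_derivation_LM1 l d); rewrite LL0.
  move: (evl l d _ _) => Q h.
  by rewrite -[RHS](addrK (Q * (d + b))) -h; ring.
have eqG l d : (d + 2 * l - b) * evl l d 1 (op x genL) =
    evl l (- l) 1 (op x genL) * ((a - 1) * d + a * l - b).
  move: (half_derivation_LL1 l d).
  move: (evl l d _ _) (evl l (- l) _ _) => G G0 h.
  by rewrite -[RHS](addrK (G * (d + b))) -h; ring.
have [a2|an2] := eqVneq a 2.
  have [g g0] := evl_poly_lambda 0 1 (op x genL).
  exists f, g; split; last by left.
  move=> l d; split => //.
    have GC e : evl l e 1 (op x genL) = evl l (- l) 1 (op x genL).
      apply: (evl_off_d (d0 := - (2 * l - b))) => {}e; rewrite -addr_eq0 => e0.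
      by apply: (cancel_off e0); rewrite addrA eqG a2; ring.
    by rewrite GC -g0 GC.
  apply: (evl_off_d (d0 := - (2 * l + b))) => {}d; rewrite -addr_eq0 => e0.
  by apply: (cancel_off e0); rewrite addrA eqQ a2; ring.
have f00 : f = 0.
  apply: poly_fun0; apply: (poly_fun_off (x0 := 0)) => l l0.
  have := eqQ l (- (2 * l + b)); rewrite [X in X * _](_ : _ = 0); last by ring.
  rewrite mul0r => /esym /eqP; rewrite mulf_eq0 => /orP[/eqP //|].
  rewrite (_ : _ + b = (a - 2) * l); last by ring.
  by rewrite mulf_eq0 subr_eq0 (negPf l0) (negPf an2).
exists f, 0; split; last by right.
move=> l d; split => //; rewrite ?f00 ?horner0.
  apply: (evl_off_lambda (t0 := b)) => {}l lb.
  have G0 : evl l (- l) 1 (op x genL) = 0.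
    have := eqG l (- (2 * l - b)).
    rewrite [X in X * _](_ : _ = 0); last by ring.
    rewrite mul0r => /esym /eqP; rewrite mulf_eq0 => /orP[/eqP //|].
    rewrite (_ : _ - b = (2 - a) * (l - b)); last by ring.
    by rewrite mulf_eq0 !subr_eq0 (negPf lb) eq_sym (negPf an2).
  apply: (evl_off_d (d0 := - (2 * l - b))) => {}d; rewrite -addr_eq0 => e0.
  by apply: (cancel_off e0); rewrite addrA eqG G0; ring.
apply: (evl_off_d (d0 := - (2 * l + b))) => {}d; rewrite -addr_eq0 => e0.
by apply: (cancel_off e0); rewrite addrA eqQ f00 horner0; ring.
Qed.

End HalfDerivations.

(** * Associative multiplication tables *)

Section Tables.
Variables (K : numFieldType).

(** The form that [half_derivation] leaves for the products: L o_ and M o_ are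
    given by (f1, g1) and (f2, g2). *)
Definition tabulated (op : lambda_product (Wmod K)) (f1 g1 f2 g2 : {poly K}) :=
  forall t d,
  [/\ evl t d 0 (op genL genL) = f1.[t], evl t d 1 (op genL genL) = g1.[t],
      evl t d 0 (op genL genM) = 0 & evl t d 1 (op genL genM) = f1.[t]] /\
  [/\ evl t d 0 (op genM genL) = f2.[t], evl t d 1 (op genM genL) = g2.[t],
      evl t d 0 (op genM genM) = 0 & evl t d 1 (op genM genM) = f2.[t]].

Lemma tabulated_assoc br op f1 g1 f2 g2 l m :
  noncomm_TPCA br op -> tabulated op f1 g1 f2 g2 ->
  [/\ f1.[m] * f1.[l] = f1.[l] * f1.[l + m] + g1.[l] * f2.[l + m],
      f1.[m] * g1.[l] + g1.[m] * f1.[l] =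
        f1.[l] * g1.[l + m] + g1.[l] * g2.[l + m],
      f1.[m] * g2.[l] + g1.[m] * f2.[l] =
        f2.[l] * g1.[l + m] + g2.[l] * g2.[l + m],
      f2.[m] * f2.[l] = f2.[l] * f2.[l + m]
    & f2.[m] * g2.[l] + g2.[m] * f2.[l] = f2.[l] * g2.[l + m]] /\
  [/\ f1.[m] * f2.[l] = f2.[l] * f1.[l + m] + g2.[l] * f2.[l + m],
      f2.[m] * f1.[l] = f1.[l] * f2.[l + m]
    & f2.[m] * g1.[l] + g2.[m] * f1.[l] = f1.[l] * g2.[l + m]].
Proof.
move=> hop tab.
have values (x y z : Wmod K) k p0 p1 q0 q1 r0 r1 s0 s1 :
  (forall t d, evl t d 0 (op y z) = p0.[t]) ->
  (forall t d, evl t d 1 (op y z) = p1.[t]) ->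
  (forall t d, evl t d k (op x genL) = q0.[t]) ->
  (forall t d, evl t d k (op x genM) = q1.[t]) ->
  (forall t d, evl t d 0 (op x y) = r0.[t]) ->
  (forall t d, evl t d 1 (op x y) = r1.[t]) ->
  (forall t d, evl t d k (op genL z) = s0.[t]) ->
  (forall t d, evl t d k (op genM z) = s1.[t]) ->
  p0.[m] * q0.[l] + p1.[m] * q1.[l] = r0.[l] * s0.[l + m] + r1.[l] * s1.[l + m].
  move=> e1 e2 e3 e4 e5 e6 e7 e8.
  have := assoc_ev2 hop l m 0 k x y z.
  by rewrite e1 e2 e3 e4 e5 e6 e7 e8.
have LL0 t d := let: conj (And4 h _ _ _) _ := tab t d in h.
have LL1 t d := let: conj (And4 _ h _ _) _ := tab t d in h.
have LM0 t d : _ = (0 : {poly K}).[t] :=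
  let: conj (And4 _ _ h _) _ := tab t d in etrans h (esym (horner0 t)).
have LM1 t d := let: conj (And4 _ _ _ h) _ := tab t d in h.
have ML0 t d := let: conj _ (And4 h _ _ _) := tab t d in h.
have ML1 t d := let: conj _ (And4 _ h _ _) := tab t d in h.
have MM0 t d : _ = (0 : {poly K}).[t] :=
  let: conj _ (And4 _ _ h _) := tab t d in etrans h (esym (horner0 t)).
have MM1 t d := let: conj _ (And4 _ _ _ h) := tab t d in h.
(* The triples (L, L, L), (M, L, L), (M, M, L) and (L, M, L). *)
split; split.
- by have := values _ _ _ _ _ _ _ _ _ _ _ _ LL0 LL1 LL0 LM0 LL0 LL1 LL0 ML0;
     rewrite ?(horner0, mulr0, mul0r, addr0, add0r).
- by have := values _ _ _ _ _ _ _ _ _ _ _ _ LL0 LL1 LL1 LM1 LL0 LL1 LL1 ML1;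
     rewrite ?(horner0, mulr0, mul0r, addr0, add0r).
- by have := values _ _ _ _ _ _ _ _ _ _ _ _ LL0 LL1 ML1 MM1 ML0 ML1 LL1 ML1;
     rewrite ?(horner0, mulr0, mul0r, addr0, add0r).
- by have := values _ _ _ _ _ _ _ _ _ _ _ _ ML0 ML1 ML0 MM0 MM0 MM1 LL0 ML0;
     rewrite ?(horner0, mulr0, mul0r, addr0, add0r).
- by have := values _ _ _ _ _ _ _ _ _ _ _ _ ML0 ML1 ML1 MM1 MM0 MM1 LL1 ML1;
     rewrite ?(horner0, mulr0, mul0r, addr0, add0r).
- by have := values _ _ _ _ _ _ _ _ _ _ _ _ LL0 LL1 ML0 MM0 ML0 ML1 LL0 ML0;
     rewrite ?(horner0, mulr0, mul0r, addr0, add0r).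
- by have := values _ _ _ _ _ _ _ _ _ _ _ _ ML0 ML1 LL0 LM0 LM0 LM1 LL0 ML0;
     rewrite ?(horner0, mulr0, mul0r, addr0, add0r).
- by have := values _ _ _ _ _ _ _ _ _ _ _ _ ML0 ML1 LL1 LM1 LM0 LM1 LL1 ML1;
     rewrite ?(horner0, mulr0, mul0r, addr0, add0r).
Qed.

End Tables.

Section Classification.
Variable K : numFieldType.
Implicit Types p : {poly K}.

Lemma shift_invariant_const p :
  (forall l m, p.[m] * p.[l] = p.[l] * p.[l + m]) -> forall t, p.[t] = p.[0].
Proof.
move=> h t; suff /eqP : p * (p - p.[0]%:P) = 0.
  rewrite mulf_eq0 subr_eq0 => /orP[/eqP->|/eqP->]; first by rewrite !horner0.
  by rewrite !hornerC.
apply: poly_fun0 => x; rewrite !hornerE mulrBr.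
by have := h x 0; rewrite addr0 mulrC => ->; rewrite subrr.
Qed.

Variables (f1 g1 f2 g2 : {poly K}).
Hypothesis assoc : forall l m,
  [/\ f1.[m] * f1.[l] = f1.[l] * f1.[l + m] + g1.[l] * f2.[l + m],
      f1.[m] * g1.[l] + g1.[m] * f1.[l] =
        f1.[l] * g1.[l + m] + g1.[l] * g2.[l + m],
      f1.[m] * g2.[l] + g1.[m] * f2.[l] =
        f2.[l] * g1.[l + m] + g2.[l] * g2.[l + m],
      f2.[m] * f2.[l] = f2.[l] * f2.[l + m]
    & f2.[m] * g2.[l] + g2.[m] * f2.[l] = f2.[l] * g2.[l + m]] /\
  [/\ f1.[m] * f2.[l] = f2.[l] * f1.[l + m] + g2.[l] * f2.[l + m],
      f2.[m] * f1.[l] = f1.[l] * f2.[l + m]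
    & f2.[m] * g1.[l] + g2.[m] * f1.[l] = f1.[l] * g2.[l + m]].

(** The equation f2(m) f2(l) = f2(l) f2(l + m) makes f2 constant. If f2 is nonzero,
    g2 is additive, hence linear, and f1 and g1 follow from it. If f2 = 0, the same
    equation holds for f1, which is constant too. If f1 = 0, then g2 = 0 and g1 is
    arbitrary. If f1 is a nonzero constant, g2 is a constant equal to 0 or f1; in
    the first case g1 is additive, in the second it is constant. *)
Lemma associative_tables :
  [\/ forall t, [/\ f1.[t] = 0, f2.[t] = 0 & g2.[t] = 0],
      exists c1 e, c1 != 0 /\ forall t,
        [/\ f1.[t] = c1, g1.[t] = e * t, f2.[t] = 0 & g2.[t] = 0],
      exists c1 e, c1 != 0 /\ forall t,
        [/\ f1.[t] = c1, g1.[t] = e, f2.[t] = 0 & g2.[t] = c1]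
    | exists c2 c d, c2 != 0 /\ forall t,
        [/\ f1.[t] = c - d * t, c2 * g1.[t] = d * t * (c - d * t),
            f2.[t] = c2 & g2.[t] = d * t]].
Proof.
have f2C : forall t, f2.[t] = f2.[0].
  by apply: shift_invariant_const => l m; case: (assoc l m) => -[].
have [c20|c20] := eqVneq f2.[0] 0.
  have f20 t : f2.[t] = 0 by rewrite f2C.
  have f1C : forall t, f1.[t] = f1.[0].
    apply: shift_invariant_const => l m; case: (assoc l m) => -[-> _ _ _ _] _.
    by rewrite f20 mulr0 addr0.
  have [c10|c10] := eqVneq f1.[0] 0.
    apply: Or41 => t; split; rewrite ?f1C //.
    have [[_ _ h _ _] _] := assoc t 0; move: h.
    rewrite addr0 f20 c10 !(mul0r, mulr0, add0r) => /esym /eqP.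
    by rewrite mulf_eq0 orbb => /eqP.
  have g2C t : g2.[t] = g2.[0].
    have [_ [_ _ h]] := assoc t 0; move: h.
    rewrite addr0 f20 mul0r add0r f1C [LHS]mulrC => h.
    by apply: (mulfI c10); rewrite h.
  have : (f1.[0] - g2.[0]) * g2.[0] = 0.
    have [[_ _ h _ _] _] := assoc 0 0; move: h.
    by rewrite addr0 !f20 mulr0 mul0r addr0 add0r mulrBl => ->; rewrite subrr.
  move/eqP; rewrite mulf_eq0 subr_eq0 => /orP[/eqP g2c|/eqP g2c].
    apply: Or43; exists f1.[0], g1.[0]; split=> // t; split=> //; last first.
      by rewrite g2C.
    have [[_ h _ _ _] _] := assoc t 0; move: h.
    by rewrite addr0 f1C g2C -g2c => /addrI /(mulIf c10) ->.
  apply: Or42; exists f1.[0], g1`_1; split=> // t; split=> //; last first.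
    by rewrite g2C.
  rewrite [in LHS](additive_poly (p := g1)) ?hornerZ ?hornerX // => x y.
  have [[_ h _ _ _] _] := assoc x y; move: h.
  rewrite !f1C g2C g2c mulr0 addr0 [_ * f1.[0]]mulrC -mulrDr.
  by move/(mulfI c10).
apply: Or44; exists f2.[0], f1.[0], g2`_1; split=> //.
have g2E t : g2.[t] = g2`_1 * t.
  rewrite [in LHS](additive_poly (p := g2)) ?hornerZ ?hornerX // => x y.
  have [[_ _ _ _ h] _] := assoc x y; move: h.
  by rewrite !f2C [_ * f2.[0]]mulrC -mulrDr => /(mulfI c20).
have f1E t : f1.[t] = f1.[0] - g2`_1 * t.
  have [_ [h _ _]] := assoc t 0; move: h.
  rewrite addr0 !f2C [_ * f2.[0]]mulrC [_ * f2.[0]]mulrC -mulrDr.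
  by move/(mulfI c20) => ->; rewrite g2E addrK.
move=> t; split=> //.
have [_ [_ _ h]] := assoc t 0; move: h.
by rewrite addr0 -f1E [g2.[0]]g2E mulr0 mul0r addr0 g2E => ->; rewrite mulrC.
Qed.

End Classification.

(** * Automorphisms of W(2, b) *)

Section BaseChange.
Variables (K : numFieldType) (b : K).

(** The map L |-> L + p (d - b) M, M |-> c M: the element p (d - b) M is what
    can be added to L without changing its bracket with itself when a = 2. *)
Definition base_change (c p : K) (x : Wmod K) : Wmod K :=
  x 0 0 *: (genL + (p *: ('X - b%:P)) *: genM) + x 0 1 *: (c%:P *: genM).

Fact base_change_is_linear c p : linear (base_change c p).
Proof.
move=> k x y; rewrite /base_change !mxE; move: (genL + _) (c%:P *: genM) => u v.
by rewrite !scalerDl -!scalerA scalerDr addrACA.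
Qed.

HB.instance Definition _ c p :=
  GRing.isLinear.Build {poly K} (Wmod K) (Wmod K) *:%R (base_change c p)
    (base_change_is_linear c p).

Lemma base_change0 c p x : (base_change c p x) 0 0 = x 0 0.
Proof. by rewrite /base_change !mxE /= !(mulr0, addr0, mulr1). Qed.

Lemma base_change1 c p x :
  (base_change c p x) 0 1 = x 0 0 * (p *: ('X - b%:P)) + x 0 1 * c%:P.
Proof. by rewrite /base_change !mxE /= !(mulr0, add0r, mulr1). Qed.

Lemma coord_base_change0 c p d x : coord d 0 (base_change c p x) = coord d 0 x.
Proof. by rewrite /coord base_change0. Qed.

Lemma coord_base_change1 c p d x :
  coord d 1 (base_change c p x) =
  coord d 0 x * (p * (d - b)) + coord d 1 x * c.
Proof. by rewrite /coord base_change1 !hornerE. Qed.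

Lemma ord2P (j : 'I_2) : j = 0 \/ j = 1.
Proof. by case: j => [[|[|//]]] ?; [left|right]; apply: val_inj. Qed.

Lemma base_changeK c p :
  c != 0 -> cancel (base_change c p) (base_change c^-1 (- (c^-1 * p))).
Proof.
move=> c0 x; apply/rowP => j.
case: (ord2P j) => ->; first by rewrite !base_change0.
rewrite base_change1 base_change0 base_change1 -!mul_polyC polyCN polyCM.
have cV : c%:P * c^-1%:P = 1 :> {poly K} by rewrite -polyCM divff.
by rewrite mulrDl -(mulrA (x 0 1)) cV; ring.
Qed.

Lemma evl_base_change0 c p t d w :
  evl t d 0 (map_coef (base_change c p) w) = evl t d 0 w.
Proof.
rewrite !evl_ev ev_map_coef evE; apply: eq_bigr => u _.
by rewrite coord_base_change0.
Qed.

Lemma evl_base_change1 c p t d w :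
  evl t d 1 (map_coef (base_change c p) w) =
  evl t d 0 w * (p * (d - b)) + evl t d 1 w * c.
Proof.
rewrite !evl_ev ev_map_coef !evE !big_distrl -big_split /=.
by apply: eq_bigr => u _; rewrite coord_base_change1 mulrDr !mulrA.
Qed.

Lemma base_change_bracket c p x y :
  map_coef (base_change c p) (W_bracket 2 b x y) =
  W_bracket 2 b (base_change c p x) (base_change c p y).
Proof.
apply: evl_inj => t d j; case: (ord2P j) => ->.
  apply: etrans (evl_base_change0 _ _ _ _ _) _.
  apply: etrans (evl_bracketL _ _ _ _ _ _) _; symmetry.
  apply: etrans (evl_bracketL _ _ _ _ _ _) _.
  by rewrite (coord_base_change0 _ _ _ x) (coord_base_change0 _ _ _ y).
apply: etrans (evl_base_change1 _ _ _ _ _) _.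
apply: etrans (congr2 (fun u v => u * _ + v * _) (evl_bracketL _ _ _ _ _ _)
  (evl_bracketM _ _ _ _ _ _)) _; symmetry.
apply: etrans (evl_bracketM _ _ _ _ _ _) _.
rewrite (coord_base_change0 _ _ _ x) (coord_base_change0 _ _ _ y).
rewrite (coord_base_change1 _ _ _ x) (coord_base_change1 _ _ _ y).
move: (coord _ _ x) (coord _ _ y) => x0 y0.
move: (coord _ _ x) (coord _ _ y) => x1 y1.
ring.
Qed.

End BaseChange.

(** * Normal forms *)

Section NormalForms.
Variables (K : numFieldType) (b : K).
Local Notation br := (W_bracket 2 b).

Lemma tabulated_evl br' (op : lambda_product (Wmod K)) f1 g1 f2 g2 t d x y :
  noncomm_TPCA br' op -> tabulated op f1 g1 f2 g2 ->
  evl t d 0 (op x y) =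
    coord (d + t) 0 y * (coord (- t) 0 x * f1.[t] + coord (- t) 1 x * f2.[t])
  /\
  evl t d 1 (op x y) =
    coord (d + t) 0 y * (coord (- t) 0 x * g1.[t] + coord (- t) 1 x * g2.[t])
    + coord (d + t) 1 y * (coord (- t) 0 x * f1.[t] + coord (- t) 1 x * f2.[t]).
Proof.
move=> [_ [conf _] _] /(_ t d) [[LL0 LL1 LM0 LM1] [ML0 ML1 MM0 MM1]].
split; apply: etrans (evl_sumr2 t d _ x y conf) _;
  apply: etrans (congr2 (fun u v => _ * u + _ * v) (evl_suml2 t d _ _ _ conf)
    (evl_suml2 t d _ _ _ conf)) _.
  by rewrite LL0 ML0 LM0 MM0 !mulr0 addr0 mulr0 addr0.
by rewrite LL1 ML1 LM1 MM1.
Qed.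

Lemma tabulated0 br' (op : lambda_product (Wmod K)) f1 g1 f2 g2 :
  noncomm_TPCA br' op -> tabulated op f1 g1 f2 g2 ->
  (forall t, [/\ f1.[t] = 0, g1.[t] = 0, f2.[t] = 0 & g2.[t] = 0]) ->
  ~ nontrivial op.
Proof.
move=> hop tab z [x [y]]; apply; apply: evl_inj => t d j.
have [-> ->] :
    evl t d j (op x y) = 0 /\ evl t d j (0 : {malg (Wmod K)[nat]}) = 0.
  split; last by rewrite evl_ev; exact: ev0.
  have [e0 e1] := tabulated_evl t d x y hop tab.
  have [z1 z2 z3 z4] := z t.
  case: (ord2P j) => ->; first by rewrite e0 z1 z3 !mulr0 addr0 mulr0.
  by rewrite e1 z1 z2 z3 z4 !mulr0 addr0 !mulr0 addr0.
by [].
Qed.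

Lemma tabulated_products (op : lambda_product (Wmod K)) f1 g1 f2 g2 :
  tabulated op f1 g1 f2 g2 ->
  products_on_generators op
    (dlscale f1^:P genL + dlscale g1^:P genM) (dlscale f1^:P genM)
    (dlscale f2^:P genL + dlscale g2^:P genM) (dlscale f2^:P genM).
Proof.
have sc f t d : (f^:P).[t%:P].[d] = f.[t] by rewrite horner_map /= hornerC.
have s0M f t d : evl t d 0 (dlscale f^:P (@genM K)) = 0.
  by apply: etrans (evl_dlscale _ _ _ _ _) _; rewrite coord_delta mulr0.
have s1L f t d : evl t d 1 (dlscale f^:P (@genL K)) = 0.
  by apply: etrans (evl_dlscale _ _ _ _ _) _; rewrite coord_delta mulr0.
have s0L f t d : evl t d 0 (dlscale f^:P (@genL K)) = f.[t].
  by apply: etrans (evl_dlscale _ _ _ _ _) _; rewrite coord_delta sc mulr1.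
have s1M f t d : evl t d 1 (dlscale f^:P (@genM K)) = f.[t].
  by apply: etrans (evl_dlscale _ _ _ _ _) _; rewrite coord_delta sc mulr1.
have add0 f g t d :
    evl t d 0 (dlscale f^:P (@genL K) + dlscale g^:P genM) = f.[t].
  apply: etrans (evlD _ _ _ _ _) _.
  exact: etrans (congr2 +%R (s0L _ _ _) (s0M _ _ _)) (addr0 _).
have add1 f g t d :
    evl t d 1 (dlscale f^:P (@genL K) + dlscale g^:P genM) = g.[t].
  apply: etrans (evlD _ _ _ _ _) _.
  exact: etrans (congr2 +%R (s1L _ _ _) (s1M _ _ _)) (add0r _).
move=> tab; split; apply: evl_inj => t d j;
  have [[LL0 LL1 LM0 LM1] [ML0 ML1 MM0 MM1]] := tab t d; case: (ord2P j) => ->.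
- exact: etrans LL0 (esym (add0 _ _ _ _)).
- exact: etrans LL1 (esym (add1 _ _ _ _)).
- exact: etrans LM0 (esym (s0M _ _ _)).
- exact: etrans LM1 (esym (s1M _ _ _)).
- exact: etrans ML0 (esym (add0 _ _ _ _)).
- exact: etrans ML1 (esym (add1 _ _ _ _)).
- exact: etrans MM0 (esym (s0M _ _ _)).
- exact: etrans MM1 (esym (s1M _ _ _)).
Qed.

(** The new table is read off in the basis L + p (d - b) M, c M. The derivation
    variable drops out of it, because (d + lambda - b) - (d - b) = lambda. *)
Lemma table_in_new_basis (op : lambda_product (Wmod K))
    f1 g1 f2 g2 c p F1 G1 F2 G2 :
  noncomm_TPCA br op -> tabulated op f1 g1 f2 g2 -> c != 0 ->
  (forall t, [/\ F1.[t] = f1.[t] - p * (t + b) * f2.[t],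
     c * G1.[t] =
       g1.[t] + p * t * f1.[t] - p * (t + b) * (g2.[t] + p * t * f2.[t]),
     F2.[t] = c * f2.[t] & G2.[t] = g2.[t] + p * t * f2.[t]]) ->
  exists op', [/\ noncomm_TPCA br op', TPCA_iso br op br op'
                & tabulated op' F1 G1 F2 G2].
Proof.
move=> hop tab c0 table.
pose phi : {linear Wmod K -> Wmod K} := base_change b c^-1 (- (c^-1 * p)).
pose psi : Wmod K -> Wmod K := base_change b c p.
have psiK : cancel psi phi by exact: base_changeK.
have phiK : cancel phi psi.
  have := @base_changeK K b c^-1 (- (c^-1 * p)); rewrite invr_eq0 => /(_ c0).
  by rewrite invrK mulrN opprK mulrA divff // mul1r.
have phi_br x y : map_coef phi (br x y) = br (phi x) (phi y).
  exact: base_change_bracket.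
have phi0 t d w : evl t d 0 (map_coef phi w) = evl t d 0 w.
  exact: evl_base_change0.
have phi1 t d w : evl t d 1 (map_coef phi w) =
    evl t d 0 w * (- (c^-1 * p) * (d - b)) + evl t d 1 w * c^-1.
  exact: evl_base_change1.
have psiL0 d : coord d 0 (psi genL) = 1.
  by rewrite coord_base_change0 coord_delta.
have psiL1 d : coord d 1 (psi genL) = p * (d - b).
  by rewrite coord_base_change1 !coord_delta mul1r mul0r addr0.
have psiM0 d : coord d 0 (psi genM) = 0.
  by rewrite coord_base_change0 coord_delta.
have psiM1 d : coord d 1 (psi genM) = c.
  by rewrite coord_base_change1 !coord_delta mul1r mul0r add0r.
clearbody phi psi.
have op'0 x y t d :
    evl t d 0 (transport phi psi op x y) = evl t d 0 (op (psi x) (psi y)).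
  exact: phi0.
have op'1 x y t d : evl t d 1 (transport phi psi op x y) =
    evl t d 0 (op (psi x) (psi y)) * (- (c^-1 * p) * (d - b))
    + evl t d 1 (op (psi x) (psi y)) * c^-1.
  exact: phi1.
exists (transport phi psi op); split.
- have [lie _ _] := hop.
  exact: (transport_TPCA (can_inj phiK) psiK phiK phi_br lie hop).
- exists phi; split=> //; first by exact: Bijective phiK psiK.
  exact: transportE.
move=> t d; have [H1 H2 H3 H4] := table t.
have val := tabulated_evl t d _ _ hop tab.
move: (val (psi genL) (psi genL)) (val (psi genL) (psi genM))
  (val (psi genM) (psi genL)) (val (psi genM) (psi genM)).
rewrite !psiL0 !psiL1 !psiM0 !psiM1.
move=> [LL0 LL1] [LM0 LM1] [ML0 ML1] [MM0 MM1].
have G1E : G1.[t] = c^-1 * (c * G1.[t]) by rewrite mulKf.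
split; split.
- by rewrite op'0 LL0 H1; ring.
- by rewrite op'1 LL0 LL1 G1E H2; field.
- by rewrite op'0 LM0; ring.
- by rewrite op'1 LM0 LM1 H1; field.
- by rewrite op'0 ML0 H3; ring.
- by rewrite op'1 ML0 ML1 H4; field.
- by rewrite op'0 MM0; ring.
- by rewrite op'1 MM0 MM1 H3; field.
Qed.

Definition listed_products (op : lambda_product (Wmod K)) : Prop :=
  (exists s : {poly K}, s != 0 /\
     products_on_generators op (dlscale s^:P genM) 0 0 0)
  \/ (exists c1 : K, c1 != 0 /\
     products_on_generators op
       (dlscale c1%:P%:P genL) (dlscale c1%:P%:P genM) 0 0)
  \/ (exists c1 : K, c1 != 0 /\
     products_on_generators op
       (dlscale c1%:P%:P genL) (dlscale c1%:P%:P genM)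
       (dlscale c1%:P%:P genM) 0)
  \/ (exists c1 : K, c1 != 0 /\
     products_on_generators op
       (dlscale c1%:P%:P genL + dlscale 1 genM) (dlscale c1%:P%:P genM)
       (dlscale c1%:P%:P genM) 0)
  \/ (exists c : K,
     products_on_generators op
       (dlscale c%:P%:P genL) (dlscale c%:P%:P genM)
       (dlscale 1 genL) (dlscale 1 genM)).

Lemma normal_form (op : lambda_product (Wmod K)) f1 g1 f2 g2 :
  noncomm_TPCA br op -> nontrivial op -> tabulated op f1 g1 f2 g2 ->
  exists op' : lambda_product (Wmod K),
    [/\ noncomm_TPCA br op', TPCA_iso br op br op' & listed_products op'].
Proof.
move=> hop hnt tab; have iso := table_in_new_basis hop tab.
have P0 : 0^:P = 0 :> {poly {poly K}} by rewrite rmorph0.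
have P1 : 1^:P = 1 :> {poly {poly K}} by rewrite rmorph1.
have PC c : (c%:P)^:P = c%:P%:P :> {poly {poly K}} by rewrite map_polyC.
have dl0 (w : Wmod K) : dlscale 0 w = 0.
  by rewrite /dlscale size_poly0 big_ord0.
have simp := (P0, P1, PC, dl0, addr0, add0r).
case: (associative_tables (fun l m => tabulated_assoc l m hop tab))
  => [h|[c1 [e [c10 h]]]|[c1 [e [c10 h]]]|[c2 [c [d [c20 h]]]]].
- have [|op' [hop' iso' /tabulated_products]] := iso 1 0 0 g1 0 0 (oner_neq0 _).
    by move=> t; have [-> -> ->] := h t; rewrite horner0; split; ring.
  rewrite !simp => prod; exists op'; split=> //; left; exists g1; split=> //.
  apply/eqP => g10; case: (tabulated0 hop tab _ hnt) => t.
  by have [-> -> ->] := h t; rewrite g10 horner0.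
(* L o L = c1 L + e lambda M becomes c1 L for p = - e / c1. *)
- have [|op' [hop' iso' /tabulated_products]] :=
    iso 1 (- (e / c1)) c1%:P 0 0 0 (oner_neq0 _).
    by move=> t; have [-> -> -> ->] := h t; rewrite !hornerC; split; field.
  by rewrite !simp => prod; exists op'; split=> //; right; left; exists c1.
- have [e0|e0] := eqVneq e 0.
    have [|op' [hop' iso' /tabulated_products]] :=
      iso 1 0 c1%:P 0 0 c1%:P (oner_neq0 _).
      by move=> t; have [-> -> -> ->] := h t; rewrite !hornerC e0; split; ring.
    rewrite !simp => prod; exists op'; split=> //.
    by do 2!right; left; exists c1.
  (* L o L = c1 L + e M, and e M is the new M. *)
  have [|op' [hop' iso' /tabulated_products]] := iso e 0 c1%:P 1 0 c1%:P e0.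
    by move=> t; have [-> -> -> ->] := h t; rewrite !hornerC; split; ring.
  rewrite !simp => prod; exists op'; split=> //.
  by do 3!right; left; exists c1.
(* M o L = c2 L + d lambda M: the new M is M / c2, and p = - d / c2 removes the
   term in lambda. The constant of L o L is then the value of f1 = c - d lambda at
   lambda = - b. *)
have c2V : c2^-1 != 0 by rewrite invr_eq0.
have [|op' [hop' iso' /tabulated_products]] :=
  iso c2^-1 (- (d / c2)) (c + d * b)%:P 0 1 0 c2V.
  move=> t; have [-> G -> ->] := h t; rewrite !hornerC.
  have {G} -> : g1.[t] = d * t * (c - d * t) / c2.
    by rewrite -G mulrAC divff ?mul1r.
  by split; field.
rewrite !simp => prod; exists op'; split=> //.
by do 4!right; exists (c + d * b).
Qed.

Lemma nontrivial_table (a : K) (op : lambda_product (Wmod K)) :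
  noncomm_TPCA (W_bracket a b) op -> nontrivial op ->
  a = 2 /\ exists f1 g1 f2 g2, tabulated op f1 g1 f2 g2.
Proof.
move=> hop hnt.
have [f1 [g1 [tabL aL]]] := half_derivation hop genL.
have [f2 [g2 [tabM aM]]] := half_derivation hop genM.
have tab : tabulated op f1 g1 f2 g2.
  by move=> t d; split; [case: (tabL t d)|case: (tabM t d)].
split; last by exists f1, g1, f2, g2.
case: aL => // -[f10 g10]; case: aM => // -[f20 g20].
case: (tabulated0 hop tab _ hnt) => t.
by rewrite f10 g10 f20 g20 horner0.
Qed.

End NormalForms.

Theorem theorem5p6 (R : realType) (a b : R[i]) (op : lambda_product (Wmod R[i]))
    (hop : noncomm_TPCA (W_bracket a b) op) (hnt : nontrivial op) :
  exists op' : lambda_product (Wmod R[i]),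
    noncomm_TPCA (W_bracket a b) op' /\
    TPCA_iso (W_bracket a b) op (W_bracket a b) op' /\
    ((exists s : {poly R[i]}, s != 0 /\
        products_on_generators op' (dlscale s^:P genM) 0 0 0)
     \/ (exists c1 : R[i], c1 != 0 /\
        products_on_generators op'
          (dlscale c1%:P%:P genL) (dlscale c1%:P%:P genM) 0 0)
     \/ (exists c1 : R[i], c1 != 0 /\
        products_on_generators op'
          (dlscale c1%:P%:P genL) (dlscale c1%:P%:P genM)
          (dlscale c1%:P%:P genM) 0)
     \/ (exists c1 : R[i], c1 != 0 /\
        products_on_generators op'
          (dlscale c1%:P%:P genL + dlscale 1 genM) (dlscale c1%:P%:P genM)
          (dlscale c1%:P%:P genM) 0)
     \/ (exists c : R[i],
        products_on_generators op'
          (dlscale c%:P%:P genL) (dlscale c%:P%:P genM)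
          (dlscale 1 genL) (dlscale 1 genM))).
Proof.
have [a2 [f1 [g1 [f2 [g2 tab]]]]] := nontrivial_table hop hnt.
rewrite {}a2 in hop *.
have [op' [hop' iso listed]] := normal_form hop hnt tab.
by exists op'.
Qed.
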